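(* Consider a Boolean control network (BCN) with $n$ state variables, $m$ inputs and $p$ outputs, with algebraic form $x(t+1)=Lu(t)x(t)$, $y(t)=Hx(t)$, where $L=[L_1,\dots,L_{2^m}]$, each $L_j\in\mathcal{L}_{2^n\times 2^n}$, and $H\in\mathcal{L}_{2^p\times 2^n}$. Assume that the BCN is decomposable with respect to outputs with order $n-s$. Let $\mathcal{G}_j$ be the directed graph with adjacency matrix $L_j$, let the vertices in $A=\{1,\dots,2^n\}$ be colored so that two vertices $\mu,\lambda$ have the same color if and only if $H\delta_{2^n}^\mu=H\delta_{2^n}^\lambda$, and let $\mathcal{S}=\{S_l\}_{l=1}^{2^s}$ (with $|S_l|=2^{n-s}$) be a common concolorous perfect equal vertex partition (CC-PEVP) of $\{\mathcal{G}_j\}_{j=1}^{2^m}$. Then $$\mathcal{S}\sqsubset\mathcal{R}^{j_1\cdots j_r}\qquad\text{for all } r\ge 0 \text{ and all } j_1,\dots,j_r\in\{1,2,\dots,2^m\}.$$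
   Context: Notation: $\delta_k^i$ is the $i$-th column of the identity matrix $I_k$, $\Delta_k=\{\delta_k^1,\dots,\delta_k^k\}$. A real $a\times b$ matrix is a logical matrix if every column lies in $\Delta_a$; $\mathcal{L}_{a\times b}$ is the set of all $a\times b$ logical matrices. $\mathrm{Col}_q(B)$ is the $q$-th column of $B$. BCN and algebraic form: let $\mathcal{D}=\{1,0\}$ (True, False). The BCN is $x_i(t+1)=f_i(x_1(t),\dots,x_n(t),u_1(t),\dots,u_m(t))$ $(1\le i\le n)$, $y_i(t)=h_i(x_1(t),\dots,x_n(t))$ $(1\le i\le p)$, with logical functions $f_i:\mathcal{D}^{n+m}\to\mathcal{D}$, $h_i:\mathcal{D}^n\to\mathcal{D}$. Identify True with $\delta_2^1$, False with $\delta_2^2$, and tuples with Kronecker products $x=x_1\otimes\cdots\otimes x_n\in\Delta_{2^n}$, $u=u_1\otimes\cdots\otimes u_m\in\Delta_{2^m}$, $y=y_1\otimes\cdots\otimes y_p\in\Delta_{2^p}$. Then $L,H$ are the unique logical matrices with $x(t+1)=L(u(t)\otimes x(t))$, written $Lu(t)x(t)$, and $y(t)=Hx(t)$; if $u(t)=\delta_{2^m}^j$ then $x(t+1)=L_jx(t)$. Decomposability: a logical coordinate transformation is a bijection $\mathcal{D}^n\to\mathcal{D}^n$, $(x_1,\dots,x_n)\mapsto(z_1,\dots,z_n)$. The BCN is decomposable with respect to outputs of (with) order $n-s$ ($0\le s\le n$) if there is a logical coordinate transformation under which it takes the form $z_i(t+1)=\hat f_i(z_1(t),\dots,z_s(t),u_1(t),\dots,u_m(t))$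 for $1\le i\le s$; $z_i(t+1)=\hat f_i(z_1(t),\dots,z_n(t),u_1(t),\dots,u_m(t))$ for $s+1\le i\le n$; $y_i(t)=\hat h_i(z_1(t),\dots,z_s(t))$ for $1\le i\le p$, with logical functions $\hat f_i,\hat h_i$. Graphs: $\mathcal{G}_j$ has vertex set $A=\{1,\dots,2^n\}$ and a directed edge $(q,k)$ if and only if $(L_j)_{kq}\neq 0$; then $k$ is an out-neighbor of $q$. $\mathcal{N}^j(S)$ denotes the set of all out-neighbors in $\mathcal{G}_j$ of vertices in $S\subset A$. Partitions: $\{S_l\}_{l=1}^{\mu}$ is a (vertex) partition of $A$ if $\bigcup_l S_l=A$ and $S_i\cap S_j=\emptyset$ for $i\ne j$ (empty members are allowed); it is an equal vertex partition if moreover $|S_l|=|A|/\mu$ for all $l$. Given a coloring of $A$, an equal vertex partition $\{S_l\}_{l=1}^\mu$ is a CC-PEVP of $\{\mathcal{G}_j\}_{j=1}^{2^m}$ if (i) for all $l$ and $j$ there exists $\alpha_l^j$ such that $\mathcal{N}^j(S_l)\subset S_{\alpha_l^j}$; and (ii) for each $l$, all vertices in $S_l$ have the same color. A partition $\mathcal{U}$ of $A$ is a refinement of a partition $\mathcal{V}$ of $A$, written $\mathcal{U}\sqsubset\mathcal{V}$, if for every $U\in\mathcal{U}$ there is $V\in\mathcal{V}$ with $U\subset V$. The partitions $\mathcal{R}^{j_1\cdots j_r}$: for $r\ge 0$, $1\le j_1,\dots,j_r\le 2^m$ and $1\le k\le 2^p$, let $R_k^{j_1\cdots j_r}=\{q\in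 A:\mathrm{Col}_q(HL_{j_1}L_{j_2}\cdots L_{j_r})=\delta_{2^p}^k\}$ (for $r=0$ the matrix is $H$), and $\mathcal{R}^{j_1\cdots j_r}=\{R_k^{j_1\cdots j_r}\}_{k=1}^{2^p}$, which is a partition of $A$. *)

(* Defs.v *)
From HB Require Import structures.
From mathcomp Require Import all_boot all_order all_algebra.
From mathcomp.real_closed Require Export mxtens.

Set Implicit Arguments.
Unset Strict Implicit.
Unset Printing Implicit Defensive.

Import Order.TTheory GRing.Theory Num.Theory.
Local Open Scope ring_scope.

(* Index sets {1, ..., k} are rendered by 'I_k, hence numbered from 0. *)

(* D ^ n, with D = bool. *)
Notation boolvec n := {ffun 'I_n -> bool}.

Section LogicalMatrices.

Variable R : realFieldType.

Definition delta (k : nat) (i : 'I_k) : 'cV[R]_k := col i 1%:M.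

Definition logical_mx (a b : nat) (M : 'M[R]_(a, b)) : Prop :=
  forall q : 'I_b, exists i : 'I_a, col q M = delta i.

Definition bool_delta (b : bool) : 'cV[R]_2 :=
  if b then delta (ord0 : 'I_2) else delta (ord_max : 'I_2).

(* x_1 (x) ... (x) x_n as a column of height 2 ^ n; the cast is needed because
   2 ^ n.+1 and 2 * 2 ^ n are not convertible. *)
Fixpoint kron_vec (n : nat) : ('I_n -> bool) -> 'cV[R]_(2 ^ n) :=
  match n with
  | 0 => fun _ => 1%:M
  | k.+1 => fun x =>
      castmx (esym (expnS 2 k), muln1 1)
        (bool_delta (x ord0) *t kron_vec (fun i : 'I_k => x (lift ord0 i)))
  end.

(* L_j, where L = [L_0, L_1, ...] is cut into blocks of b columns: column q of
   L_j is column j * b + q of L. *)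
Definition block (a c b : nat) (L : 'M[R]_(a, c * b)) (j : 'I_c) :
    'M[R]_(a, b) :=
  colsub (fun q : 'I_b => mxtens_index (j, q)) L.

End LogicalMatrices.

Arguments delta {R k} i.
Arguments bool_delta {R} b.
Arguments kron_vec {R n} x.

Record bcn (n m p : nat) := BCN {
  bcn_f : 'I_n -> boolvec n -> boolvec m -> bool;
  bcn_h : 'I_p -> boolvec n -> bool
}.

Definition next_state n m p (B : bcn n m p) (x : boolvec n) (u : boolvec m) :
    boolvec n :=
  [ffun i => bcn_f B i x u].

Definition output n m p (B : bcn n m p) (x : boolvec n) : boolvec p :=
  [ffun i => bcn_h B i x].

Definition algebraic_form (R : realFieldType) n m p (B : bcn n m p)
    (L : 'M[R]_(2 ^ n, 2 ^ m * 2 ^ n)) (H : 'M[R]_(2 ^ p, 2 ^ n)) : Prop :=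
  [/\ logical_mx L,
      logical_mx H,
      forall (x : boolvec n) (u : boolvec m),
        kron_vec (next_state B x u) = L *m (kron_vec u *t kron_vec x)
    & forall x : boolvec n, kron_vec (output B x) = H *m kron_vec x].

Definition first_coords (n s : nat) (hs : (s <= n)%N) (z : boolvec n) :
    boolvec s :=
  [ffun i => z (widen_ord hs i)].

(* Decomposability with respect to outputs with order n - s. *)
Definition decomposable n m p (B : bcn n m p) (s : nat) (hs : (s <= n)%N) :
    Prop :=
  exists (T : boolvec n -> boolvec n)
         (f1 : 'I_s -> boolvec s -> boolvec m -> bool)
         (f2 : 'I_n -> boolvec n -> boolvec m -> bool)
         (h : 'I_p -> boolvec s -> bool),
    [/\ bijective T,
        forall (x : boolvec n) (u : boolvec m) (i : 'I_s),
          T (next_state B x u) (widen_ord hs i)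
            = f1 i (first_coords hs (T x)) u,
        forall (x : boolvec n) (u : boolvec m) (i : 'I_n), (s <= i)%N ->
          T (next_state B x u) i = f2 i (T x) u
      & forall (x : boolvec n) (i : 'I_p),
          output B x i = h i (first_coords hs (T x))].

Section Graphs.

Variable V : finType.

Definition out_neighbors (G : rel V) (S : {set V}) : {set V} :=
  [set k | [exists q in S, G q k]].

(* Indexed families, so that empty and repeated empty members are allowed. *)
Definition vertex_partition (I : finType) (S : I -> {set V}) : Prop :=
  \bigcup_l S l = [set: V] /\ (forall i j, i != j -> S i :&: S j = set0).

(* The division is exact: the members are disjoint, cover V and all have the
   same cardinality. *)
Definition equal_vertex_partition (mu : nat) (S : 'I_mu -> {set V}) : Prop :=
  vertex_partition S /\ (forall l, #|S l| = (#|V| %/ mu)%N).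

Definition cc_pevp (C : Type) (color : V -> C) (J : finType) (G : J -> rel V)
    (mu : nat) (S : 'I_mu -> {set V}) : Prop :=
  [/\ equal_vertex_partition S,
      forall l j, exists a, out_neighbors (G j) (S l) \subset S a
    & forall l, {in S l &, forall v w, color v = color w}].

Definition refines (I J : finType) (S : I -> {set V}) (W : J -> {set V}) :
    Prop :=
  forall i, exists j, S i \subset W j.

End Graphs.

(* The graph on 'I_N with an edge (q, k) iff the (k, q) entry is nonzero. *)
Definition mx_graph (R : realFieldType) (N : nat) (M : 'M[R]_N) : rel 'I_N :=
  [rel q k | M k q != 0].

(* The family R^{j_1 ... j_r}, indexed by k; for r = 0 the product is 1%:M. *)
Definition output_partition (R : realFieldType) (N M P : nat)
    (L : 'M[R]_(N, M * N)) (H : 'M[R]_(P, N)) (r : nat) (js : 'I_r -> 'I_M)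
    (k : 'I_P) : {set 'I_N} :=
  [set q | col q (H *m \prod_(i < r) block L (js i)) == delta k].

(* Main.v *)
(* By induction on r, the column v of H L_{j_1} ... L_{j_r} is the same for all
   v in a cell of S: multiplying on the right by L_j replaces column v by the
   column of the unique out-neighbor of v in G_j, and the out-neighbors of a
   cell lie in a single cell. *)

Require Import Defs.
From mathcomp Require Import all_boot all_order all_algebra.

Set Implicit Arguments.
Unset Strict Implicit.
Unset Printing Implicit Defensive.

Local Open Scope ring_scope.

Lemma mulmx_delta (R : realFieldType) (a b : nat) (M : 'M[R]_(a, b))
    (q : 'I_b) : M *m delta q = col q M.
Proof. by rewrite /delta !colE mul1mx. Qed.

(** With [N] the matrix of one input, right multiplication moves the column index from [q] to its
    successor [k]. *)
Lemma col_mul_delta (R : realFieldType) (a b c : nat) (M : 'M[R]_(a, b))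
    (N : 'M[R]_(b, c)) (q : 'I_c) (k : 'I_b) :
  col q N = delta k -> col q (M *m N) = col k M.
Proof. by move=> Nq; rewrite colE -mulmxA -colE Nq mulmx_delta. Qed.

Lemma logical_mul (R : realFieldType) (a b c : nat) (M : 'M[R]_(a, b))
    (N : 'M[R]_(b, c)) :
  logical_mx M -> logical_mx N -> logical_mx (M *m N).
Proof.
move=> hM hN q; have [k Nq] := hN q; have [i Mk] := hM k.
by exists i; rewrite (col_mul_delta _ Nq).
Qed.

Lemma logical_block (R : realFieldType) (a c b : nat) (L : 'M[R]_(a, c * b))
    (j : 'I_c) : logical_mx L -> logical_mx (block L j).
Proof.
move=> hL q; have [i Li] := hL (mxtens_index (j, q)).
by exists i; rewrite -Li; apply/colP=> k; rewrite !mxE.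
Qed.

(** Bridge from matrices to graphs: the entry of [M] in row [k] and column [q] is 1, hence
    nonzero. *)
Lemma mx_graph_col_delta (R : realFieldType) (N : nat) (M : 'M[R]_N)
    (q k : 'I_N) : col q M = delta k -> mx_graph M q k.
Proof.
by move/colP/(_ k); rewrite !mxE eqxx /mx_graph /= => ->; rewrite GRing.oner_neq0.
Qed.

Section OutputWords.

Variables (R : realFieldType) (N M P : nat).
Variables (L : 'M[R]_(N, M * N)) (H : 'M[R]_(P, N)).
Hypotheses (hL : logical_mx L) (hH : logical_mx H).

(** Ensures that every vertex belongs to some member of [output_partition]. *)
Lemma logical_output_word (r : nat) (js : 'I_r -> 'I_M) :
  logical_mx (H *m \prod_(i < r) block L (js i)).
Proof.
elim: r js => [|r IHr] js; first by rewrite big_ord0 mulmx1.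
by rewrite big_ord_recr /= mulmxA; apply/logical_mul/logical_block.
Qed.

Variables (I : finType) (S : I -> {set 'I_N}).
Hypothesis S_step : forall l j, exists a,
  out_neighbors (mx_graph (block L j)) (S l) \subset S a.
Hypothesis S_output : forall l, {in S l &, forall v w, col v H = col w H}.

Lemma output_word_const (r : nat) (js : 'I_r -> 'I_M) (l : I) :
  {in S l &, forall v w,
     col v (H *m \prod_(i < r) block L (js i)) =
     col w (H *m \prod_(i < r) block L (js i))}.
Proof.
(* The cell [l] is generalized because the induction hypothesis is applied to the successor cell
   [a]. *)
elim: r js l => [|r IHr] js l v w Sv Sw.
  by rewrite big_ord0 mulmx1; apply: S_output Sv Sw.
(* The rightmost factor is split off, since it is the one that acts first on a basis vector. *)
rewrite big_ord_recr /= mulmxA.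
set j := js ord_max; have [a /subsetP Sa] := S_step l j.
(* The index [a] is fixed before [x], so the successors of [v] and [w] land in the same cell. *)
have next x : x \in S l -> exists2 k, col x (block L j) = delta k & k \in S a.
  move=> Sx; have [k Lx] := logical_block j hL x; exists k => //.
  apply: Sa; rewrite inE; apply/existsP; exists x.
  by rewrite Sx; apply: mx_graph_col_delta.
have [v' Lv Sv'] := next v Sv; have [w' Lw Sw'] := next w Sw.
by rewrite (col_mul_delta _ Lv) (col_mul_delta _ Lw); apply: IHr Sv' Sw'.
Qed.

Lemma refines_output_partition (r : nat) (js : 'I_r -> 'I_M) :
  (0 < P)%N -> refines S (output_partition L H js).
Proof.
move=> P_gt0 l; have [-> | [q Sq]] := set_0Vmem (S l).
  (* An empty cell lies in any member; index 0 exists because [P] is positive. *)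
  by exists (Ordinal P_gt0); apply: sub0set.
(* The column at one vertex [q] of the cell determines the member; constancy on the cell brings in
   the other vertices. *)
have [k Hq] := logical_output_word js q.
exists k; apply/subsetP=> v Sv; rewrite inE -Hq.
by apply/eqP; apply: output_word_const Sv Sq.
Qed.

End OutputWords.

Theorem proposition4 (R : realFieldType) (n m p s : nat) (hs : (s <= n)%N)
    (B : bcn n m p)
    (L : 'M[R]_(2 ^ n, 2 ^ m * 2 ^ n)) (H : 'M[R]_(2 ^ p, 2 ^ n))
    (hLH : algebraic_form B L H)
    (hB : decomposable B hs)
    (C : Type) (color : 'I_(2 ^ n) -> C)
    (hcolor : forall v w : 'I_(2 ^ n),
       color v = color w <-> H *m delta v = H *m delta w)
    (S : 'I_(2 ^ s) -> {set 'I_(2 ^ n)})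
    (hS : cc_pevp color (fun j : 'I_(2 ^ m) => mx_graph (block L j)) S) :
  forall (r : nat) (js : 'I_r -> 'I_(2 ^ m)),
    refines S (output_partition L H js).
Proof.
move=> r js; have [hL hH _ _] := hLH; have [_ hstep hcol] := hS.
apply: refines_output_partition; rewrite ?expn_gt0 // => l v w Sv Sw.
(* Equal colors within a cell become equal columns of [H], the base case of the induction. *)
by rewrite -!mulmx_delta; apply/hcolor; apply: hcol Sv Sw.
Qed.
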